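(* Let $a\geq 1$ and $m\geq 1$ be integers. Then $$\sum_{k=0}^{3^a m-1} q^{k}{2k\brack k}_q\equiv 0\pmod{\prod_{j=1}^a \Phi_{3^j}(q)},$$ $$\sum_{k=0}^{5^a m-1}(-1)^kq^{-\binom{k+1}{2}}{2k\brack k}_q\equiv 0\pmod{\prod_{j=1}^a \Phi_{5^j}(q)}.$$
   Context: ${n\brack k}_q$ is the $q$-binomial coefficient, equal to $\frac{(q;q)_n}{(q;q)_k(q;q)_{n-k}}$ if $0\le k\le n$ and $0$ otherwise, where $(z;q)_n=(1-z)(1-zq)\cdots(1-zq^{n-1})$; it is a polynomial in $q$ with integer coefficients. $\Phi_n(q)$ is the $n$th cyclotomic polynomial; note that $\prod_{j=1}^a\Phi_{p^j}(q)=(1-q^{p^a})/(1-q)$ for any prime $p$. Congruences are between Laurent polynomials, i.e. in the ring $\mathbb{Z}[q,q^{-1}]$. *)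

(* Defs.v *)
From mathcomp Require Import all_boot all_order all_algebra all_field.

Set Implicit Arguments.
Unset Strict Implicit.
Unset Printing Implicit Defensive.

Import GRing.Theory.
Local Open Scope ring_scope.

(* Laurent polynomials are taken inside the field Q(q) of fractions of Z[q]:
   Z[q, q^-1] is the subring of all P / q^n with P in Z[q]. *)
Definition ratfun := {fraction {poly int}}.

Definition ratfun_of_poly (P : {poly int}) : ratfun := tofrac P.

Definition q : ratfun := ratfun_of_poly 'X.

Definition laurent (x : ratfun) : Prop :=
  exists (P : {poly int}) (n : nat), x = ratfun_of_poly P / q ^+ n.

Definition laurent_congr (M x y : ratfun) : Prop :=
  [/\ laurent x, laurent y & exists2 C, laurent C & x - y = C * M].

(* (z; q)_n *)
Definition qpoch (z : ratfun) (n : nat) : ratfun :=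
  \prod_(i < n) (1 - z * q ^+ i).

Definition qbinom (n k : nat) : ratfun :=
  if (k <= n)%N then qpoch q n / (qpoch q k * qpoch q (n - k)) else 0.

(* Main.v *)
Require Import Defs.
From mathcomp Require Import all_boot all_order all_algebra all_field.
From mathcomp Require Import zify ring.
Import GRing.Theory.
Local Open Scope ring_scope.

(* Divisibility by the product of the Phi_(p^j) amounts to vanishing at every
   complex w != 1 with w^(p^a) = 1; such a w has order n = p^j with j > 0, and n
   divides the number N of summands.

   For p = 3, telescoping in N gives
     sum_(k < N) q^k [2k, k]
       = sum_i q^(3i(2i+1)) ([2N, N-3i-1] - q^(6i+3) [2N, N-3i-2]),
   and [2N, N-j] vanishes at w unless n divides j, which would force 3 | j.

   For p = 5, [2(in+r), in+r] = [2in, in] [2r, r] at w (a weak q-Lucas property),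
   so the sum is a multiple of its part with k < n.  At w one has
   (-1)^r w^(-C(r+1,2)) [2r, r] = w^(r^2) [n-1-r, r], so this part is
   the Rogers-Ramanujan polynomial sum_r q^(r^2) [n-1-r, r].  Schur's identity
   expands it as sum_i q^(i(10i+1)) [2s, s-5i] - q^((2i+1)(5i+3)) [2s, s-5i-3]
   with n = 2s+1, and since [n-1, k+1] = - w^(-k-1) [n-1, k], the term i+1 of the
   first kind cancels the term i of the second kind when 5 | n. *)

(** * Gaussian binomial coefficients *)

(** Pascal's recursion makes sense in every commutative ring, in particular at roots of unity, where
    the quotient of products can become 0 / 0. *)
Fixpoint gauss {R : comNzRingType} (x : R) (n k : nat) : R :=
  match n, k with
  | _, 0 => 1
  | 0, _.+1 => 0
  | n'.+1, k'.+1 => gauss x n' k' + x ^+ k * gauss x n' k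
  end.

Arguments gauss : simpl never.

Lemma gauss_map (R S : comNzRingType) (f : {rmorphism R -> S}) (x : R) (n k : nat) :
  f (gauss x n k) = gauss (f x) n k.
Proof.
elim: n k => [|n IHn] [|k]; rewrite ?rmorph1 ?rmorph0 //.
rewrite (_ : gauss x _ _ = gauss x n k + x ^+ k.+1 * gauss x n k.+1) //.
by rewrite rmorphD rmorphM rmorphXn !IHn.
Qed.

Section Gauss.
Variables (R : comNzRingType) (x : R).
Local Notation g := (gauss x).

Lemma gauss0 n : g n 0 = 1. Proof. by case: n. Qed.

Lemma gaussS n k : g n.+1 k.+1 = g n k + x ^+ k.+1 * g n k.+1.
Proof. by []. Qed.

Lemma gauss_small n k : (n < k)%N -> g n k = 0.
Proof.
elim: n k => [|n IHn] [|k] // lt_nk.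
by rewrite gaussS !IHn ?mulr0 ?addr0 //; lia.
Qed.

Lemma gauss_diag n : g n n = 1.
Proof. by elim: n => // n IHn; rewrite gaussS IHn gauss_small // mulr0 addr0. Qed.

(** The ratio of neighbours in a row, kept free of division because 1 - x^(k+1) may be 0. The
    truncated [n - k] is harmless: both sides are 0 when k >= n. *)
Lemma gauss_step n k :
  g n k.+1 * (1 - x ^+ k.+1) = g n k * (1 - x ^+ (n - k)).
Proof.
elim: n k => [|n IHn] k.
  by rewrite gauss_small // sub0n subrr mul0r mulr0.
have [le_kn | lt_nk] := leqP k n; last first.
  by rewrite gauss_small ?mul0r // (_ : n.+1 - k = 0)%N ?subrr ?mulr0 //; lia.
case: k le_kn => [|k] le_kn.
  by rewrite gaussS !gauss0 mulrDl -mulrA IHn gauss0 !subn0 expr1 exprS; ring.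
rewrite gaussS mulrDl -mulrA IHn gaussS mulrDl subSS -(IHn k).
have -> : (n - k = (n - k.+1).+1)%N by lia.
rewrite !exprS; ring.
Qed.

Lemma gauss_absorb n k :
  g n.+1 k.+1 * (1 - x ^+ k.+1) = g n k * (1 - x ^+ n.+1).
Proof.
have [le_kn | lt_nk] := leqP k n; last by rewrite !gauss_small ?mul0r.
rewrite gaussS mulrDl -mulrA gauss_step.
have -> : n.+1 = (k.+1 + (n - k))%N by lia.
rewrite exprD; ring.
Qed.

Lemma gauss_absorb_top n k :
  g n.+1 k * (1 - x ^+ (n.+1 - k)) = g n k * (1 - x ^+ n.+1).
Proof. by rewrite -gauss_step gauss_absorb. Qed.

Lemma gauss_pascal n k : g n.+1 k.+1 = x ^+ (n - k) * g n k + g n k.+1.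
Proof.
apply/eqP; rewrite gaussS -subr_eq0; apply/eqP.
transitivity (g n k * (1 - x ^+ (n - k)) - g n k.+1 * (1 - x ^+ k.+1)).
  by ring.
by rewrite gauss_step subrr.
Qed.

Lemma gauss_central n :
  g (2 * n.+1) n.+1 * (1 - x ^+ n.+1) ^+ 2 =
  g (2 * n) n * (1 - x ^+ (2 * n).+1) * (1 - x ^+ (2 * n).+2).
Proof.
rewrite mulnS !addSn add0n expr2 mulrA gauss_absorb.
have := gauss_absorb_top (2 * n) n.
rewrite (_ : (2 * n).+1 - n = n.+1)%N; last by lia.
by rewrite mulrAC => ->.
Qed.

(** One row up and one column on: this compares [n-1-r, r] for consecutive r, as [gauss_central]
    compares [2r, r]. *)
Lemma gauss_knight n k :
  g n k.+1 * (1 - x ^+ k.+1) * (1 - x ^+ n.+1) =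
  g n.+1 k * (1 - x ^+ (n.+1 - k)) * (1 - x ^+ (n - k)).
Proof. by rewrite gauss_absorb_top gauss_step; ring. Qed.

End Gauss.

(** * Gaussian coefficients with an integer lower index *)

(** Extension by 0 to negative lower indices, so that both Pascal rules hold without boundary
    cases. *)
Definition zgauss {R : comNzRingType} (x : R) (n : nat) (k : int) : R :=
  if k is Posz k' then gauss x n k' else 0.

Section ZGauss.
Variables (F : fieldType) (x : F) (x0 : x != 0).
Local Notation z := (zgauss x).

Lemma zgauss_small (n : nat) (k : int) : (k < 0) || (n%:Z < k) -> z n k = 0.
Proof. by case: k => // k /=; move=> lt_nk; rewrite gauss_small //; lia. Qed.

Lemma zgaussS (n : nat) (k : int) : z n.+1 k = z n (k - 1) + x ^ k * z n k.
Proof.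
case: k => [[|k]|k].
- by rewrite expr0z mul1r add0r /= !gauss0.
- by have -> : Posz k.+1 - 1 = k by lia.
- by rewrite !zgauss_small ?mulr0 ?addr0 //; lia.
Qed.

Lemma zgauss_pascal (n : nat) (k : int) :
  z n.+1 k = x ^ (n.+1%:Z - k) * z n (k - 1) + z n k.
Proof.
case: k => [[|k]|k].
- by rewrite [z n (_ - _)]zgauss_small //= mulr0 add0r !gauss0.
- have -> : Posz k.+1 - 1 = k by lia.
  rewrite [LHS]/= gauss_pascal; congr (_ + _).
  have [le_kn | lt_nk] := leqP k n; last by rewrite /= gauss_small ?mulr0.
  by have -> : n.+1%:Z - k.+1%:Z = (n - k)%N by lia.
- by rewrite !zgauss_small ?mulr0 ?addr0 //; lia.
Qed.

(* Equating the two Pascal rules eliminates the term in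
   [x ^ n * x ^ n] from the increment [zgauss_incr]. *)
Lemma zgauss_neighbours (n : nat) (j : int) :
  x ^ n * (x ^ (- j) * z (2 * n) (n%:Z - j)
           - x ^ (j + 1) * z (2 * n) (n%:Z - j - 1)) =
  z (2 * n) (n%:Z - j) - z (2 * n) (n%:Z - j - 1).
Proof.
have := zgaussS (2 * n) (n%:Z - j); rewrite zgauss_pascal.
have -> : (2 * n).+1%:Z - (n%:Z - j) = n%:Z + (j + 1) by lia.
rewrite !expfzDr // => /eqP; rewrite -subr_eq0 => /eqP eq0.
apply/eqP; rewrite -subr_eq0 -oppr_eq0 -[X in _ == X]eq0; apply/eqP.
ring.
Qed.

(** From row 2n to row 2n+2 at fixed distance j from the centre: one Pascal rule, then the other on
    both terms, leaves the neighbours at distances j+1 and j-1 and x^(2n+1) times the term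
    itself. *)
Lemma zgauss_incr (n : nat) (j : int) :
  z (2 * n.+1) (n.+1%:Z - j) - z (2 * n) (n%:Z - j) =
  x ^ n * (x ^ (j + 1) * z (2 * n) (n%:Z - j - 1)
           + x ^ (1 - j) * z (2 * n) (n%:Z - j + 1)
           + x ^ n * x * z (2 * n) (n%:Z - j)).
Proof.
rewrite mulnS !addSn add0n zgaussS.
have -> : n.+1%:Z - j - 1 = n%:Z - j by lia.
rewrite !(zgauss_pascal (2 * n)).
have -> : (2 * n).+1%:Z - (n%:Z - j) = n%:Z + (j + 1) by lia.
have -> : (2 * n).+1%:Z - (n.+1%:Z - j) = n%:Z + j by lia.
have -> : n.+1%:Z - j - 1 = n%:Z - j by lia.
have -> : n.+1%:Z - j = n%:Z + (1 - j) by lia.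
have -> : n%:Z + (1 - j) = n%:Z - j + 1 by lia.
have -> : x ^ (n%:Z - j + 1) = x ^ n * x ^ (1 - j).
  by rewrite -expfzDr //; congr (_ ^ _); lia.
have jV : x ^ (1 - j) * x ^ j = x.
  by rewrite -expfzDr // (_ : 1 - j + j = 1) //; lia.
rewrite !expfzDr //; rewrite expfzDr // in jV.
have -> : x ^ n * x * z (2 * n) (n%:Z - j) =
  x ^ n * (x ^ 1 * x ^ (- j) * x ^ j) * z (2 * n) (n%:Z - j).
  by rewrite jV.
ring.
Qed.

(** * Telescoping of the sum for p = 3 *)

Definition block3 n (i : nat) : F :=
  x ^+ (3 * i * (2 * i).+1) *
  (z (2 * n) (n%:Z - (3 * i).+1%:Z)
   - x ^+ (6 * i + 3) * z (2 * n) (n%:Z - (3 * i).+2%:Z)).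

Definition edge3 n (i : nat) : F :=
  x ^+ (6 * i ^ 2) * z (2 * n) (n%:Z - (3 * i)%:Z).

(** By [zgauss_incr], distances 3i+1 and 3i+2 interact with each other and with 3i and 3i+3. The
    mutual terms cancel by [zgauss_neighbours]; the outer ones are the edges, which telescope in
    i. *)
Lemma block3_incr n i :
  block3 n.+1 i - block3 n i = x ^+ n * (edge3 n i - edge3 n i.+1).
Proof.
rewrite /block3 -mulrBr.
have := zgauss_incr n (3 * i).+1%:Z; have := zgauss_incr n (3 * i).+2%:Z.
have := zgauss_neighbours n (3 * i).+1%:Z.
have -> : n%:Z - (3 * i).+1%:Z - 1 = n%:Z - (3 * i).+2%:Z by lia.
have -> : n%:Z - (3 * i).+1%:Z + 1 = n%:Z - (3 * i)%:Z by lia.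
have -> : n%:Z - (3 * i).+2%:Z + 1 = n%:Z - (3 * i).+1%:Z by lia.
have -> : n%:Z - (3 * i).+2%:Z - 1 = n%:Z - (3 * i.+1)%:Z by lia.
rewrite /edge3.
move: (z _ (n%:Z - (3 * i)%:Z)) (z _ (n%:Z - (3 * i).+1%:Z)) => b0 b1.
move: (z _ (n%:Z - (3 * i).+2%:Z)) (z _ (n%:Z - (3 * i.+1)%:Z)) => b2 b3.
move: (z _ (n.+1%:Z - (3 * i).+1%:Z)) (z _ (n.+1%:Z - (3 * i).+2%:Z)) => c1 c2.
have e1 : x ^+ (3 * i * (2 * i).+1) = x ^+ (6 * i ^ 2) * (x ^+ i) ^+ 3.
  by rewrite -exprM -exprD; congr (_ ^+ _); nia.
have e2 : x ^+ (6 * i + 3) = (x ^+ i) ^+ 6 * x ^+ 3.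
  by rewrite -exprM -exprD; congr (_ ^+ _); lia.
have e3 : x ^+ (6 * i.+1 ^ 2) = x ^+ (6 * i ^ 2) * (x ^+ i) ^+ 12 * x ^+ 6.
  by rewrite -exprM -!exprD; congr (_ ^+ _); lia.
have p1 : x ^ (- (3 * i).+1%:Z) = ((x ^+ i) ^+ 3 * x)^-1.
  by rewrite -exprnN -exprM mulnC -exprSr.
have p2 : x ^ ((3 * i).+1%:Z + 1) = (x ^+ i) ^+ 3 * x ^+ 2.
  by rewrite -exprM -exprD (_ : _ + 1 = (i * 3 + 2)%N%:Z) //; lia.
have p3 : x ^ ((3 * i).+2%:Z + 1) = (x ^+ i) ^+ 3 * x ^+ 3.
  by rewrite -exprM -exprD (_ : _ + 1 = (i * 3 + 3)%N%:Z) //; lia.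
have p4 : x ^ (1 - (3 * i).+1%:Z) = ((x ^+ i) ^+ 3)^-1.
  rewrite -exprM (_ : 1 - (3 * i).+1%:Z = - (i * 3)%N%:Z); last by lia.
  by rewrite -exprnN.
have p5 : x ^ (1 - (3 * i).+2%:Z) = ((x ^+ i) ^+ 3 * x)^-1.
  rewrite -exprM -exprSr (_ : 1 - (3 * i).+2%:Z = - (i * 3).+1%:Z); last by lia.
  by rewrite -exprnN.
rewrite e1 e2 e3 p1 p2 p3 p4 p5 -!exprnP => nb d2 d1.
have y0 : x ^+ i != 0 by rewrite expf_neq0.
move: (x ^+ i) (x ^+ n) (x ^+ (6 * i ^ 2)) y0 nb d1 d2 => y u w y0 nb d1 d2.
transitivity (w * y ^+ 3 * ((c1 - b1) - y ^+ 6 * x ^+ 3 * (c2 - b2))).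
  by ring.
rewrite d1 d2; apply/eqP; rewrite -subr_eq0; apply/eqP.
(* The difference of the two sides is a multiple of [zgauss_neighbours] at j = 3i+1. *)
transitivity (u * x ^+ 2 * w * y ^+ 6 *
  (u * ((y ^+ 3 * x)^-1 * b1 - y ^+ 3 * x ^+ 2 * b2) - (b1 - b2))).
  by field; rewrite x0.
by rewrite nb subrr mulr0.
Qed.

(** The number [m] of blocks stays fixed during the induction on [n]. Summing [block3_incr] leaves
    only the edge at i = 0, which is the new summand x^n [2n, n]; the edge at m lies outside the
    row. *)
Lemma sum_central3 (n m : nat) : (n <= m)%N ->
  \sum_(0 <= k < n) x ^+ k * gauss x (2 * k) k = \sum_(0 <= i < m) block3 n i.
Proof.
elim: n => [|n IHn] le_nm.
  rewrite big_geq // big1 // => i _; rewrite /block3.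
  by rewrite !zgauss_small ?mulr0 ?subrr ?mulr0 //; lia.
rewrite big_nat_recr //= IHn 1?ltnW //; apply/esym/eqP.
rewrite addrC -subr_eq -sumrB; apply/eqP.
under eq_bigr do rewrite block3_incr.
rewrite -mulr_sumr (@telescope_sumr_eq _ _ _ (fun i => - edge3 n i)) //.
  rewrite [in - edge3 n m]/edge3 zgauss_small ?mulr0; last by lia.
  by rewrite /edge3 expr0 mul1r subr0 oppr0 add0r opprK.
by move=> i _; rewrite opprK addrC.
Qed.

(** In [N, k] (1 - x^k) = [N-1, k-1] (1 - x^N) the last factor is 0, while 1 - x^k is not. *)
Lemma zgauss_prim_root_eq0 (n N : nat) (k : int) :
  n.-primitive_root x -> (n %| N)%N -> ~~ (n %| k)%Z -> z N k = 0.
Proof.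
case: k => [k|k] // prim_x dvd_nN ndvd_nk.
case: k ndvd_nk => [|k] ndvd_nk; first by rewrite dvdz0 in ndvd_nk.
case: N dvd_nN => [|N] dvd_nN; first by rewrite zgauss_small.
have nz: 1 - x ^+ k.+1 != 0.
  by rewrite subr_eq0 eq_sym -(prim_order_dvd prim_x).
apply: (mulIf nz); rewrite mul0r [z _ _]/= gauss_absorb.
have /eqP -> : x ^+ N.+1 == 1 by rewrite -(prim_order_dvd prim_x).
by rewrite subrr mulr0.
Qed.

Lemma sum_central3_prim_root (n N : nat) :
  n.-primitive_root x -> (3 %| n)%N -> (n %| N)%N ->
  \sum_(0 <= k < N) x ^+ k * gauss x (2 * k) k = 0.
Proof.
move=> prim_x dvd_3n dvd_nN; rewrite (sum_central3 _ _ (leqnn N)) big1 // => i _.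
have dvd_3z (k : int) : (n %| k)%Z -> (3 %| k)%Z by apply: dvdz_trans.
have dvd_3N : (3 %| N%:Z)%Z by apply: dvd_3z.
rewrite /block3 !(zgauss_prim_root_eq0 n _ _ prim_x) ?mulr0 ?subrr ?mulr0 //.
- by rewrite dvdn_mull.
- by apply/negP => /dvd_3z; lia.
- by rewrite dvdn_mull.
- by apply/negP => /dvd_3z; lia.
Qed.
End ZGauss.

(** * Schur's identity *)

Section Schur.
Variables (F : fieldType) (x : F) (x0 : x != 0).
Local Notation z := (zgauss x).

Definition schur (n : nat) : F :=
  \sum_(0 <= r < n.+1) x ^+ (r ^ 2) * gauss x (n - r) r.

Lemma schur0 : schur 0 = 1.
Proof. by rewrite /schur big_nat1 expr0 mul1r. Qed.

Lemma schur1 : schur 1 = 1.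
Proof.
by rewrite /schur big_nat_recr //= big_nat1 gauss0 mul1r gauss_small ?mulr0 ?addr0.
Qed.

(** Pascal's rule splits [n+1-r, r+1], and (r+1)^2 + (n-2r) = r^2 + (n+1) brings out the factor
    x^(n+1). *)
Lemma schur_rec n : schur n.+2 = schur n.+1 + x ^+ n.+1 * schur n.
Proof.
rewrite /schur big_nat_recr //= subnn [gauss x 0 _]gauss_small // mulr0 addr0.
rewrite [in LHS]big_nat_recl // [X in _ = X + _]big_nat_recl // !gauss0 -addrA.
congr (_ + _); rewrite mulr_sumr -big_split /=.
apply: eq_big_nat => r /andP[_ le_rn].
have -> : (n.+2 - r.+1 = (n - r).+1)%N by lia.
have -> : (n.+1 - r.+1 = n - r)%N by lia.
have [le_r|lt_r] := leqP r (n - r); last first.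
  by rewrite !gauss_small ?mulr0 ?addr0 //; lia.
rewrite gauss_pascal mulrDr addrC !mulrA -!exprD.
by congr (x ^+ _ * _ + _); nia.
Qed.

(** Summand, over all integers i, of Schur's expansion of [schur (2 * s)]; [odd5] is its counterpart
    for [schur (2 * s).+1]. *)
Definition even5 (s : nat) (i : int) : F :=
  x ^ (i * (10 * i + 1)) * z (2 * s) (s%:Z - 5 * i)
  - x ^ ((2 * i + 1) * (5 * i + 3)) * z (2 * s) (s%:Z - 5 * i - 3).

Definition odd5 (s : nat) (i : int) : F :=
  x ^ (i * (10 * i + 1)) * z (2 * s).+1 (s%:Z - 5 * i)
  - x ^ ((2 * i + 1) * (5 * i + 3)) * z (2 * s).+1 (s%:Z - 5 * i - 2).

Definition edge5 (s : nat) (i : int) : F :=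
  x ^ (i * (10 * i + 1) + s%:Z + 1 - 5 * i) * z (2 * s) (s%:Z + 1 - 5 * i).

(** Turns exponents affine in [s] and [i] into monomials in x^s and x^i, on which [field] can
    work. *)
Lemma expz_affine (s : nat) (i : int) (b : nat) (c e : int) :
  e = s%:Z + b%:Z * i + c -> x ^ e = x ^+ s * (x ^ i) ^+ b * x ^ c.
Proof. by move=> ->; rewrite !expfzDr // [b%:Z * i]mulrC -exprz_exp. Qed.

Lemma expz_affineN (s : nat) (i : int) (b : nat) (c e : int) :
  e = s%:Z - b%:Z * i + c -> x ^ e = x ^+ s * (x ^ i) ^- b * x ^ c.
Proof.
move=> ->; rewrite !expfzDr // (_ : - (b%:Z * i) = i * - b%:Z); last by ring.
by rewrite -exprz_exp -exprnN.
Qed.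

Lemma expz_quadratic (i : int) :
  x ^ ((2 * i + 1) * (5 * i + 3)) =
  x ^ (i * (10 * i + 1)) * (x ^ i) ^+ 10 * x ^+ 3.
Proof.
have -> : (2 * i + 1) * (5 * i + 3) = i * (10 * i + 1) + i * 10%:Z + 3 by ring.
by rewrite !expfzDr // -(exprz_exp x i 10).
Qed.

(** The recurrence of [schur] holds term by term here: the rules are applied in such an order that
    the two copies of [2s+1, s-5i-1] cancel. *)
Lemma odd5_step s i : odd5 s.+1 i = even5 s.+1 i + x ^+ (2 * s).+2 * odd5 s i.
Proof.
rewrite /odd5 /even5 mulnS !addSn add0n expz_quadratic.
have -> : z (2 * s).+3 (s.+1%:Z - 5 * i) =
    x ^ (s%:Z + 5 * i + 2) * z (2 * s).+2 (s%:Z - 5 * i)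
    + z (2 * s).+2 (s.+1%:Z - 5 * i).
  by rewrite zgauss_pascal //; congr (_ ^ _ * z _ _ + _); lia.
have -> : z (2 * s).+2 (s%:Z - 5 * i) =
    z (2 * s).+1 (s%:Z - 5 * i - 1)
    + x ^ (s%:Z - 5 * i) * z (2 * s).+1 (s%:Z - 5 * i).
  by rewrite zgaussS //.
have -> : z (2 * s).+3 (s.+1%:Z - 5 * i - 2) =
    z (2 * s).+2 (s%:Z - 5 * i - 2)
    + x ^ (s%:Z - 5 * i - 1) * z (2 * s).+2 (s%:Z - 5 * i - 1).
  by rewrite zgaussS //; congr (z _ _ + _ ^ _ * z _ _); lia.
have -> : z (2 * s).+2 (s%:Z - 5 * i - 1) =
    x ^ (s%:Z + 5 * i + 3) * z (2 * s).+1 (s%:Z - 5 * i - 2)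
    + z (2 * s).+1 (s%:Z - 5 * i - 1).
  by rewrite zgauss_pascal //; congr (_ ^ _ * z _ _ + _); lia.
have -> : s.+1%:Z - 5 * i - 3 = s%:Z - 5 * i - 2 by lia.
rewrite (expz_affine s i 5 2 (s%:Z + 5 * i + 2)) //.
rewrite (expz_affineN s i 5 (-1) (s%:Z - 5 * i - 1)) //.
rewrite (expz_affine s i 5 3 (s%:Z + 5 * i + 3)) //.
rewrite (expz_affineN s i 5 0 (s%:Z - 5 * i)) ?addr0 //.
have v0 : x ^ i != 0 by rewrite expfz_neq0.
have -> : x ^+ (2 * s).+2 = (x ^+ s) ^+ 2 * x ^+ 2.
  by rewrite -exprM -exprD; congr (_ ^+ _); lia.
rewrite -[x ^ 2]/(x ^+ 2) -[x ^ 3]/(x ^+ 3) -[x ^ (-1)]/(x^-1) expr0z.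
move: (x ^ i) (x ^+ s) (x ^ (i * _)) v0 => v u w v0.
by field; rewrite x0.
Qed.

(** Here [2s, s+1-5i] and [2s, s-5i-4] are left over. They are the edges at i and i+1, hence
    disappear after summation. *)
Lemma even5_step s i :
  even5 s.+1 i = odd5 s i + x ^+ (2 * s).+1 * even5 s i
                 + (edge5 s i - edge5 s (i + 1)).
Proof.
rewrite /odd5 /even5 /edge5 mulnS !addSn add0n expz_quadratic.
have -> : z (2 * s).+2 (s.+1%:Z - 5 * i) =
    z (2 * s).+1 (s%:Z - 5 * i)
    + x ^ (s%:Z - 5 * i + 1) * z (2 * s).+1 (s.+1%:Z - 5 * i).
  by rewrite zgaussS //; congr (z _ _ + _ ^ _ * z _ _); lia.
have -> : z (2 * s).+1 (s.+1%:Z - 5 * i) =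
    x ^ (s%:Z + 5 * i) * z (2 * s) (s%:Z - 5 * i)
    + z (2 * s) (s%:Z + 1 - 5 * i).
  by rewrite zgauss_pascal //; congr (_ ^ _ * z _ _ + z _ _); lia.
have -> : z (2 * s).+2 (s.+1%:Z - 5 * i - 3) =
    x ^ (s%:Z + 5 * i + 4) * z (2 * s).+1 (s%:Z - 5 * i - 3)
    + z (2 * s).+1 (s%:Z - 5 * i - 2).
  by rewrite zgauss_pascal //; congr (_ ^ _ * z _ _ + z _ _); lia.
have -> : z (2 * s).+1 (s%:Z - 5 * i - 3) =
    z (2 * s) (s%:Z + 1 - 5 * (i + 1))
    + x ^ (s%:Z - 5 * i - 3) * z (2 * s) (s%:Z - 5 * i - 3).
  by rewrite zgaussS //; congr (z _ _ + _ ^ _ * z _ _); lia.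
have -> : x ^ (i * (10 * i + 1) + s%:Z + 1 - 5 * i) =
    x ^ (i * (10 * i + 1)) * x ^ (s%:Z - 5 * i + 1).
  by rewrite -expfzDr //; congr (_ ^ _); ring.
have -> : x ^ ((i + 1) * (10 * (i + 1) + 1) + s%:Z + 1 - 5 * (i + 1)) =
    x ^ (i * (10 * i + 1)) * x ^ (s%:Z + 15%:Z * i + 7).
  by rewrite -expfzDr //; congr (_ ^ _); ring.
rewrite (expz_affine s i 5 4 (s%:Z + 5 * i + 4)) //.
rewrite (expz_affineN s i 5 1 (s%:Z - 5 * i + 1)) //.
rewrite (expz_affineN s i 5 (-3) (s%:Z - 5 * i - 3)) //.
rewrite (expz_affine s i 15 7 (s%:Z + 15%:Z * i + 7)) //.
rewrite (expz_affine s i 5 0 (s%:Z + 5 * i)) ?addr0 //.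
have v0 : x ^ i != 0 by rewrite expfz_neq0.
have -> : x ^+ (2 * s).+1 = (x ^+ s) ^+ 2 * x.
  by rewrite -exprM -exprSr; congr (_ ^+ _); lia.
rewrite -[x ^ 4]/(x ^+ 4) -[x ^ 7]/(x ^+ 7) -[x ^ (-3)]/(x^-3) expr0z expr1z.
move: (x ^ i) (x ^+ s) (x ^ (i * _)) v0 => v u w v0.
by field; rewrite v0.
Qed.

(** Finite substitute for a sum over all integers, centred at 0 and shifted to natural indices. *)
Definition window (m : nat) (f : int -> F) : F :=
  \sum_(0 <= t < (2 * m).+1) f (t%:Z - m%:Z).

Lemma window_telescope m f :
  window m (fun i => f i - f (i + 1)) = f (- m%:Z) - f (m%:Z + 1).
Proof.
rewrite /window (@telescope_sumr_eq _ _ _ (fun t : nat => - f (t%:Z - m%:Z))) //.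
  by rewrite opprK addrC; congr (f _ - f _); lia.
by move=> t _; rewrite opprK addrC; congr (- f _ + _); lia.
Qed.

Lemma window_delta m f : (forall i, i != 0 -> f i = 0) -> window m f = f 0.
Proof.
move=> f0; rewrite /window (bigD1_seq m) ?iota_uniq ?mem_index_iota //=; last by lia.
by rewrite subrr big1 ?addr0 // => t t_m; apply: f0; lia.
Qed.

Lemma even5_0 i : i != 0 -> even5 0 i = 0.
Proof.
by move=> i0; rewrite /even5 !zgauss_small ?mulr0 ?subr0 //; lia.
Qed.

Lemma odd5_0 i : i != 0 -> odd5 0 i = 0.
Proof.
by move=> i0; rewrite /odd5 !zgauss_small ?mulr0 ?subr0 //; lia.
Qed.

(** The recurrence alternates parities, so both expansions are proved together. *)
Lemma schur_window m s : (s <= 5 * m)%N ->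
  schur (2 * s) = window m (even5 s) /\ schur (2 * s).+1 = window m (odd5 s).
Proof.
elim: s => [|s IHs] le_sm.
  rewrite !window_delta; [|exact: odd5_0|exact: even5_0].
  rewrite muln0 schur0 schur1 /even5 /odd5 mulr0 subr0 muln0 mul0r expr0z !mul1r.
  by split; rewrite /= !gauss0 mulr0 subr0.
have [IHe IHo] := IHs (ltnW le_sm).
have even : schur (2 * s.+1) = window m (even5 s.+1).
  rewrite mulnS !addSn add0n schur_rec IHe IHo.
  have -> : window m (even5 s.+1) = window m (odd5 s)
      + x ^+ (2 * s).+1 * window m (even5 s)
      + window m (fun i => edge5 s i - edge5 s (i + 1)).
    rewrite /window mulr_sumr -!big_split /=.
    by apply: eq_bigr => t _; rewrite even5_step.
  (* The two end edges have lower indices s+1+5m > 2s and s-4-5m < 0. *)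
  rewrite window_telescope /edge5 !zgauss_small ?mulr0 ?subrr ?addr0 //; lia.
split=> //; rewrite mulnS !addSn add0n schur_rec -[(2 * s).+2]/(2 + 2 * s)%N -mulnS.
rewrite even IHo /window mulr_sumr -big_split /=.
by apply: eq_bigr => t _; rewrite odd5_step mulnS.
Qed.

(** Since x^(n-k) = x^(-k-1), the ratio in [gauss_step] is (1 - x^(-k-1)) / (1 - x^(k+1)) =
    -x^(-k-1). At each excluded k exactly one of the two coefficients is 0. *)
Lemma zgauss_prim_root_step n (k : int) :
  n.+1.-primitive_root x -> k != -1 -> k != n%:Z ->
  z n (k + 1) = - x ^ (- (k + 1)) * z n k.
Proof.
move=> prim_x; case: k => [k|k] k1 kn; last first.
  by rewrite !zgauss_small ?mulr0 //; lia.
have [lt_kn|lt_nk] := ltnP k n; last first.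
  by rewrite !zgauss_small ?mulr0 //; lia.
have nz : 1 - x ^+ k.+1 != 0.
  rewrite subr_eq0 eq_sym -(prim_order_dvd prim_x).
  by apply/negP => /dvdn_leq; lia.
have -> : k%:Z + 1 = k.+1%:Z by lia.
apply: (mulIf nz); rewrite [z _ _]/= gauss_step -exprnN.
have -> : x ^+ (n - k) = x ^- k.+1.
  apply: (mulIf (expf_neq0 k.+1 x0)); rewrite mulVf ?expf_neq0 // -exprD.
  by rewrite (_ : (n - k + k.+1 = n.+1)%N) ?(prim_expr_order prim_x) //; lia.
rewrite [z _ _]/=; field.
by rewrite expf_neq0.
Qed.

Lemma schur_prim_root n :
  n.-primitive_root x -> (5 %| n)%N -> odd n -> schur n.-1 = 0.
Proof.
move=> prim_x dvd_5n odd_n; pose s := n./2.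
have def_n : n = (2 * s).+1 by rewrite -[LHS]odd_double_half odd_n -mul2n.
rewrite def_n in prim_x dvd_5n *.
have [-> _] := @schur_window s s ltac:(lia).
pose h i := x ^ (i * (10 * i + 1)) * z (2 * s) (s%:Z - 5 * i).
have even_h i : even5 s i = h i - h (i + 1).
  rewrite /even5 /h; congr (_ - _).
  have -> : s%:Z - 5 * i - 3 = s%:Z - 5 * (i + 1) + 1 + 1 by lia.
  (* As 5 divides 2s+1, s is 2 mod 5: the two steps start from indices that are 2 and 3 mod 5, while
     the excluded -1 and 2s are 4 mod 5. *)
  rewrite !zgauss_prim_root_step //; try lia.
  rewrite !(mulNr, mulrN) opprK !mulrA -!expfzDr //; congr (_ * _).
  (* The exponents differ by 2s+1, the order of x. *)
  have -> : (i + 1) * (10 * (i + 1) + 1) =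
     (2 * i + 1) * (5 * i + 3) - (s%:Z - 5 * (i + 1) + 1 + 1)
     - (s%:Z - 5 * (i + 1) + 1) + (2 * s).+1%:Z.
    by rewrite (_ : (2 * s).+1%:Z = 2 * s%:Z + 1); [ring | lia].
  by rewrite [RHS]expfzDr // -exprnP (prim_expr_order prim_x) mulr1.
have -> : window s (even5 s) = window s (fun i => h i - h (i + 1)).
  by apply: eq_bigr => t _; exact: even_h.
by rewrite window_telescope /h !zgauss_small ?mulr0 ?subrr //; lia.
Qed.
End Schur.

(** * The alternating sum at a root of unity *)

Lemma double_bin2S m : (2 * 'C(m.+1, 2) = m.+1 * m)%N.
Proof. by elim: m => // m IHm; rewrite binS bin1 mulnDr IHm; lia. Qed.

Section Central5.
Variables (F : fieldType) (x : F) (n : nat).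
Hypothesis prim_x : n.-primitive_root x.

Lemma prim_root_neq0 : x != 0.
Proof.
apply/eqP => x0; have /eqP := prim_expr_order prim_x.
by rewrite x0 expr0n gtn_eqF ?(prim_order_gt0 prim_x) // eq_sym oner_eq0.
Qed.

Lemma prim_root_subX_neq0 r : (r.+1 < n)%N -> 1 - x ^+ r.+1 != 0.
Proof.
move=> lt_rn; rewrite subr_eq0 eq_sym -(prim_order_dvd prim_x).
by apply/negP => /dvdn_leq; lia.
Qed.

(** The factors in [gauss_central] depend on the indices only modulo n, and 1 - x^(r+1) is nonzero
    for r+1 < n; so both sides obey the same recurrence in r. *)
Lemma gauss_central_lucas i r : (r < n)%N ->
  gauss x (2 * (i * n + r)) (i * n + r) =
  gauss x (2 * (i * n)) (i * n) * gauss x (2 * r) r.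
Proof.
elim: r => [|r IHr] lt_rn; first by rewrite addn0 muln0 gauss0 mulr1.
have nz := expf_neq0 2 (prim_root_subX_neq0 _ lt_rn).
have xn k j : x ^+ (k * n + j) = x ^+ j.
  by rewrite exprD mulnC exprM (prim_expr_order prim_x) expr1n mul1r.
have xr : x ^+ (i * n + r).+1 = x ^+ r.+1 by rewrite -addnS xn.
apply: (mulIf nz); rewrite -{1}xr addnS gauss_central.
rewrite -[RHS]mulrA gauss_central IHr 1?ltnW //.
have -> : (2 * (i * n + r)).+1 = ((2 * i) * n + (2 * r).+1)%N by lia.
by rewrite -addnS !xn; ring.
Qed.

(** Induction on r: [gauss_central] gives the ratio on the left, [gauss_knight] that on the right,
    and x^(n-k) = x^(-k) matches them. *)
Lemma gauss_central_reflect r : (r < n)%N ->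
  (-1) ^+ r * x ^- 'C(r.+1, 2) * gauss x (2 * r) r =
  x ^+ (r ^ 2) * gauss x (n.-1 - r) r.
Proof.
have x0 := prim_root_neq0.
elim: r => [|r IHr] lt_rn; first by rewrite !gauss0 invr1 !mulr1.
have nz := expf_neq0 2 (prim_root_subX_neq0 _ lt_rn).
apply: (mulIf nz); rewrite -[LHS]mulrA gauss_central binS bin1 exprD exprS.
transitivity (- x ^- r.+1 * (x ^+ (r ^ 2) * gauss x (n.-1 - r) r)
              * (1 - x ^+ (2 * r).+1) * (1 - x ^+ (2 * r).+2)).
  rewrite -IHr 1?ltnW // invfM.
  move: (x ^- 'C(_, _)) (x ^- r.+1) ((-1) ^+ r) (gauss _ _ _) => c y e g.
  by ring.
have xV k : (k <= n)%N -> x ^+ (n - k) = x ^- k.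
  move=> le_kn; apply: (mulIf (expf_neq0 k x0)).
  by rewrite -exprD subnK // (prim_expr_order prim_x) mulVf ?expf_neq0.
(* For n < 2r+2 the new right side is 0. On the left, 1 - x^(2r+1) is 0 if n = 2r+1, and [n-1-r, r]
   is 0 for smaller n. *)
have [le_rn|lt_nr] := leqP (2 * r).+2 n; last first.
  rewrite [gauss x (_ - r.+1) _]gauss_small; last by lia.
  rewrite mulr0 mul0r; have [eq_rn|ne_rn] := eqVneq n (2 * r).+1.
    by rewrite -eq_rn (prim_expr_order prim_x) subrr mulr0 mul0r.
  by rewrite gauss_small ?(mulr0, mul0r) //; lia.
have := gauss_knight _ x (n.-1 - r.+1) r.
have -> : (n.-1 - r.+1).+1 = (n - r.+1)%N by lia.
have -> : (n - r.+1 - r = n - (2 * r).+1)%N by lia.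
have -> : (n.-1 - r.+1 - r = n - (2 * r).+2)%N by lia.
have -> : (n.-1 - r = n - r.+1)%N by lia.
have -> : x ^+ (r.+1 ^ 2) = x ^+ (r ^ 2) * (x ^+ r) ^+ 2 * x.
  by rewrite -exprM -exprD -exprSr; congr (_ ^+ _); lia.
rewrite !xV; try lia.
rewrite !exprSr mulnC exprM.
have y0 : x ^+ r != 0 by rewrite expf_neq0.
move: (gauss x _ r.+1) (gauss x _ r) (x ^+ r) (x ^+ (r ^ 2)) y0 => g1 g0 y w y0 kn.
apply/eqP; rewrite -subr_eq0; apply/eqP.
transitivity (w * y ^+ 3 * x ^+ 2 * (
   g1 * (1 - y * x) * (1 - (y * x)^-1)
   - g0 * (1 - (y ^+ 2 * x)^-1) * (1 - (y ^+ 2 * x * x)^-1))).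
  by field; rewrite x0.
by rewrite kn subrr mulr0.
Qed.

Lemma sum_central5_prim_root N : (5 %| n)%N -> odd n -> (n %| N)%N ->
  \sum_(0 <= k < N) (-1) ^+ k * x ^- 'C(k.+1, 2) * gauss x (2 * k) k = 0.
Proof.
move=> dvd_5n odd_n /dvdnP[m ->]; rewrite big_nat_mul big1 // => i _.
transitivity ((-1) ^+ i * gauss x (2 * (i * n)) (i * n) * schur _ x n.-1).
  rewrite /schur prednK ?(prim_order_gt0 prim_x) // mulr_sumr.
  rewrite -{1}[(i * n)%N]add0n mulSn big_addn addnK.
  apply: eq_big_nat => r /andP[_ lt_rn].
  rewrite [(r + _)%N]addnC gauss_central_lucas // -gauss_central_reflect //.
  have -> : x ^+ 'C((i * n + r).+1, 2) = x ^+ 'C(r.+1, 2).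
    (* Twice this binomial is (i n + 1) i n, and the odd n is coprime to 2. *)
    have dvd_n : (n %| 'C((i * n).+1, 2))%N.
      rewrite -(@Gauss_dvdr _ 2) ?coprimen2 // double_bin2S mulnA.
      by rewrite dvdn_mull.
    have -> : 'C((i * n + r).+1, 2)
              = (i * r * n + 'C((i * n).+1, 2) + 'C(r.+1, 2))%N.
      have := double_bin2S (i * n + r); have := double_bin2S (i * n).
      by have := double_bin2S r; nia.
    apply/eqP; rewrite (eq_prim_root_expr prim_x) eqn_mod_dvd ?leq_addl //.
    by rewrite addnK dvdn_add // dvdn_mull.
  have -> : (-1) ^+ (i * n + r) = (-1) ^+ i * (-1) ^+ r :> F.
    by rewrite exprD -signr_odd oddM odd_n andbT signr_odd.
  ring.
by rewrite schur_prim_root ?mulr0 // prim_root_neq0.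
Qed.
End Central5.

(** * From roots of unity to congruences *)

Lemma prod_Cyclotomic_pfactor p a : prime p ->
  ('X - 1) * \prod_(1 <= j < a.+1) 'Phi_(p ^ j) = 'X^(p ^ a) - 1.
Proof.
move=> p_pr; have pa_gt0 : (0 < p ^ a)%N by rewrite expn_gt0 prime_gt0.
have p_gt1 := prime_gt1 p_pr.
have Phi1 : 'Phi_1 = 'X - 1 by rewrite -[RHS](@prod_Cyclotomic 1) // big_seq1.
rewrite -(prod_Cyclotomic pa_gt0) -Phi1.
transitivity (\prod_(0 <= j < a.+1) 'Phi_(p ^ j)).
  by rewrite [RHS]big_ltn // expn0.
rewrite -(big_map (expn p) xpredT (fun d => 'Phi_d)).
apply/perm_big/uniq_perm; rewrite ?divisors_uniq //.
  by rewrite map_inj_uniq ?iota_uniq //; exact: expnI.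
move=> d; rewrite -dvdn_divisors //; apply/mapP/(dvdn_pfactor _ _ p_pr).
  by case=> j; rewrite mem_index_iota => lt_ja ->; exists j.
by case=> j le_ja ->; exists j; rewrite ?mem_index_iota.
Qed.

(** Over [algC] the product splits into distinct X - w, so it divides P there. Being monic, it also
    allows division over the integers; a nonzero remainder would be a multiple of it over [algC] of
    smaller size. *)
Lemma dvd_prod_Cyclotomic_pfactor p a (P : {poly int}) : prime p ->
    (forall w : algC, w ^+ (p ^ a) = 1 -> w != 1 -> (map_poly intr P).[w] = 0) ->
  exists Q, P = Q * \prod_(1 <= j < a.+1) 'Phi_(p ^ j).
Proof.
move=> p_pr P0; set M := \prod_(_ <= _ < _) _.
have pa_gt0 : (0 < p ^ a)%N by rewrite expn_gt0 prime_gt0.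
have M_mon : M \is monic by apply: monic_prod => j _; exact: Cyclotomic_monic.
pose f : {poly int} -> {poly algC} := map_poly intr.
have size_f R : size (f R) = size R by rewrite size_map_inj_poly //; exact: intr_inj.
have M_dvd : f M %| f P.
  have [z prim_z] := C_prim_root_exists pa_gt0.
  have -> : f M = \prod_(w <- [seq z ^+ i | i <- index_iota 1 (p ^ a)]) ('X - w%:P).
    have X1_neq0 : 'X - 1%:P != 0 :> {poly algC} by rewrite polyXsubC_eq0.
    rewrite big_map; apply: (mulfI X1_neq0).
    transitivity (f ('X^(p ^ a) - 1)).
      rewrite -prod_Cyclotomic_pfactor // [RHS]rmorphM /=.
      by rewrite rmorphB /= map_polyX !rmorph1.
    rewrite /f rmorphB !rmorph1 /= map_polyXn -(factor_Xn_sub_1 prim_z).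
    by rewrite big_ltn // expr0.
  apply: uniq_roots_dvdp.
    apply/allP => w /mapP[i]; rewrite mem_index_iota => /andP[i_gt0 lt_i] ->{w}.
    apply/rootP/P0; first by rewrite exprAC (prim_expr_order prim_z) expr1n.
    rewrite -(prim_order_dvd prim_z); apply/negP => /dvdn_leq.
    by rewrite i_gt0 leqNgt lt_i => /(_ isT).
  rewrite uniq_rootsE map_inj_in_uniq ?iota_uniq // => i j.
  rewrite !mem_index_iota => /andP[_ lt_i] /andP[_ lt_j] /eqP.
  by rewrite (eq_prim_root_expr prim_z) !modn_small // => /eqP.
have P_eq := Pdiv.RingMonic.rdivp_eq M_mon P.
exists (Pdiv.Ring.rdivp P M); rewrite [LHS]P_eq.
suff /eqP -> : Pdiv.Ring.rmodp P M == 0 by rewrite addr0.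
rewrite -size_poly_eq0 -size_f size_poly_eq0; apply: contraTT isT => r_neq0.
have r_dvd : f M %| f (Pdiv.Ring.rmodp P M).
  rewrite -(dvdp_addr _ (dvdp_mull (f (Pdiv.Ring.rdivp P M)) (dvdpp (f M)))).
  by rewrite -rmorphM -rmorphD -P_eq.
have := dvdp_leq r_neq0 r_dvd; rewrite !size_f leqNgt.
by rewrite Pdiv.Ring.ltn_rmodp monic_neq0.
Qed.

(** Dividing by the unit [q ^+ D] preserves divisibility; [D] accommodates negative powers of q. *)
Lemma laurent_congr_prod_Cyclotomic p a (P : {poly int}) D : prime p ->
    (forall w : algC, w ^+ (p ^ a) = 1 -> w != 1 -> (map_poly intr P).[w] = 0) ->
  laurent_congr (ratfun_of_poly (\prod_(1 <= j < a.+1) 'Phi_(p ^ j)))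
    (ratfun_of_poly P / q ^+ D) 0.
Proof.
move=> p_pr /(dvd_prod_Cyclotomic_pfactor _ _ _ p_pr)[Q ->].
set M := \prod_(_ <= _ < _) _; split.
- by exists (Q * M), D.
- by exists 0, 0; rewrite /ratfun_of_poly rmorph0 mul0r.
- exists (ratfun_of_poly Q / q ^+ D); first by exists Q, D.
  by rewrite /ratfun_of_poly subr0 rmorphM mulrAC.
Qed.

(** * The q-binomial coefficients as polynomials, and their evaluation *)

Lemma qpoch_neq0 n : qpoch q n != 0.
Proof.
apply/prodf_neq0 => i _; rewrite -exprS subr_eq0.
rewrite /q /ratfun_of_poly -tofrac1 -tofracXn tofrac_eq.
apply/eqP => /(congr1 (fun P : {poly int} => size P)).
by rewrite size_poly1 size_polyXn.
Qed.

Lemma gauss_qpoch n k : (k <= n)%N ->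
  gauss q n k * (qpoch q k * qpoch q (n - k)) = qpoch q n.
Proof.
have qpochS m : qpoch q m.+1 = qpoch q m * (1 - q ^+ m.+1).
  by rewrite /qpoch big_ord_recr /= exprS.
elim: n => [|n IHn].
  by rewrite leqn0 => /eqP->; rewrite /qpoch big_ord0 gauss0 !mulr1.
rewrite leq_eqVlt => /orP[/eqP->|le_kn].
  by rewrite gauss_diag subnn /qpoch big_ord0 mul1r mulr1.
rewrite subSn // !qpochS -subSn // -(IHn le_kn) [RHS]mulrAC -gauss_absorb_top.
by ring.
Qed.

Lemma qbinomE n k : qbinom n k = ratfun_of_poly (gauss 'X n k).
Proof.
rewrite /ratfun_of_poly gauss_map -/(ratfun_of_poly 'X) -/q /qbinom.
have [le_kn|lt_nk] := leqP k n; last by rewrite gauss_small.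
by rewrite -(gauss_qpoch _ _ le_kn) mulfK // mulf_neq0 ?qpoch_neq0.
Qed.

Lemma prim_order_pfactor (F : fieldType) (w : F) p a :
  prime p -> w ^+ (p ^ a) = 1 -> w != 1 ->
  exists2 j, (0 < j <= a)%N & (p ^ j).-primitive_root w.
Proof.
move=> p_pr wpa w1; have pa_gt0 : (0 < p ^ a)%N by rewrite expn_gt0 prime_gt0.
have [n prim_w] := prim_order_exists pa_gt0 wpa.
case/(dvdn_pfactor _ _ p_pr) => j le_ja def_n; rewrite def_n in prim_w.
exists j => //; rewrite le_ja andbT lt0n; apply: contra_neq w1 => j0.
by have := prim_expr_order prim_w; rewrite j0 expr1.
Qed.

Lemma horner_gauss (F : fieldType) (w : F) n k :
  (map_poly intr (gauss 'X n k : {poly int})).[w] = gauss w n k.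
Proof.
rewrite gauss_map /= map_polyX -[LHS]/(horner_eval w _) gauss_map.
by rewrite /= /horner_eval hornerX.
Qed.

Lemma expf_subV {F : fieldType} {y : F} {d e : nat} :
  y != 0 -> (e <= d)%N -> y ^+ (d - e) / y ^+ d = y ^- e.
Proof.
move=> y0 /subnK def_d; rewrite -{2}def_d exprD invfM mulrA mulfV ?mul1r //.
exact: expf_neq0.
Qed.

Theorem theorem3p4 (a m : nat) (ha : (1 <= a)%N) (hm : (1 <= m)%N) :
  laurent_congr (ratfun_of_poly (\prod_(1 <= j < a.+1) 'Phi_(3 ^ j)))
    (\sum_(0 <= k < 3 ^ a * m) q ^+ k * qbinom (2 * k) k) 0
  /\
  laurent_congr (ratfun_of_poly (\prod_(1 <= j < a.+1) 'Phi_(5 ^ j)))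
    (\sum_(0 <= k < 5 ^ a * m)
       (-1) ^+ k * q ^- 'C(k.+1, 2) * qbinom (2 * k) k) 0.
Proof.
have order_dvd p n j : (0 < j <= a)%N ->
    ((p %| p ^ j)%N * (p ^ j %| p ^ a * n)%N)%type.
  case/andP=> j_gt0 le_ja; split; first by rewrite dvdn_exp.
  by rewrite dvdn_mulr // dvdn_exp2l.
have q0 : q != 0 by rewrite /q /ratfun_of_poly tofrac_eq0 polyX_eq0.
split.
- set N := (_ * m)%N.
  pose P : {poly int} := \sum_(0 <= k < N) 'X^k * gauss 'X (2 * k) k.
  have -> : \sum_(0 <= k < N) q ^+ k * qbinom (2 * k) k
            = ratfun_of_poly P / q ^+ 0.
    rewrite divr1 /ratfun_of_poly rmorph_sum; apply: eq_bigr => k _.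
    by rewrite qbinomE rmorphM rmorphXn.
  apply: laurent_congr_prod_Cyclotomic => // w wpa w1.
  have [j le_ja prim_w] := prim_order_pfactor _ _ _ _ (isT : prime 3) wpa w1.
  have [dvd_3n dvd_nN] := order_dvd 3 m j le_ja.
  have w0 := prim_root_neq0 _ _ _ prim_w.
  rewrite rmorph_sum horner_sum.
  rewrite -[RHS](sum_central3_prim_root _ _ w0 _ N prim_w) //.
  apply: eq_bigr => k _; rewrite rmorphM hornerM /= map_polyXn hornerXn.
  by rewrite horner_gauss.
(* [D] bounds every ['C(k.+1, 2)] with k < N, so q^D clears all denominators at once. *)
- set N := (_ * m)%N; pose D := 'C(N.+1, 2).
  have le_D k : (k < N)%N -> ('C(k.+1, 2) <= D)%N.
    by move=> lt_kN; apply: leq_bin2l; lia.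
  pose P : {poly int} :=
    \sum_(0 <= k < N) (-1) ^+ k * 'X^(D - 'C(k.+1, 2)) * gauss 'X (2 * k) k.
  have -> : \sum_(0 <= k < N) (-1) ^+ k * q ^- 'C(k.+1, 2) * qbinom (2 * k) k
            = ratfun_of_poly P / q ^+ D.
    rewrite /ratfun_of_poly rmorph_sum mulr_suml.
    apply: eq_big_nat => k /andP[_ lt_kN].
    rewrite qbinomE -(expf_subV q0 (le_D k lt_kN)) !rmorphM !rmorphXn rmorphN1.
    by rewrite -!mulrA; congr (_ * (_ * _)); exact: mulrC.
  apply: laurent_congr_prod_Cyclotomic => // w wpa w1.
  have [j le_ja prim_w] := prim_order_pfactor _ _ _ _ (isT : prime 5) wpa w1.
  have [dvd_5n dvd_nN] := order_dvd 5 m j le_ja.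
  have w0 := prim_root_neq0 _ _ _ prim_w.
  have wD0 : (w ^+ D)^-1 != 0 by rewrite invr_neq0 ?expf_neq0.
  (* Multiplying by w^(-D) restores the negative exponents of the original sum. *)
  rewrite rmorph_sum horner_sum; apply: (mulIf wD0).
  rewrite mul0r -[RHS](sum_central5_prim_root _ _ _ prim_w N) ?oddX ?orbT //.
  rewrite mulr_suml; apply: eq_big_nat => k /andP[_ lt_kN].
  rewrite -(expf_subV w0 (le_D k lt_kN)) !rmorphM !rmorphXn rmorphN1 !hornerM.
  rewrite /= map_polyX horner_gauss hornerXn horner_exp hornerN hornerC.
  by rewrite -!mulrA; congr (_ * (_ * _)); exact: mulrC.
Qed.
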